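(* Let $K$ be a symmetric convex body in $\mathbb{R}^d$, with modulus of convexity $\delta_K$. Then $$f(K)\geq \left(2^d+(3-2\delta_K(1/2))^d\right)^{-1}$$ and (for $d\ge 2$) $$F(K)\geq (e+o(1))^{-1}(d\log d)^{-1}\left(2^d+(3-2\delta_K(1/2))^d\right)^{-1},$$ where $o(1)$ denotes a function of $d$ alone (independent of $K$) tending to $0$ as $d\to\infty$.
   Context: For measurable $E\subseteq\mathbb{R}^d$, $|E|$ denotes Lebesgue measure. A symmetric convex body $K\subseteq\mathbb{R}^d$ is the closed unit ball of a (unique) norm $\lVert\cdot\rVert_K$ on $\mathbb{R}^d$. The constant $F(K)$ is the largest $c\ge 0$ such that every finite collection $\mathcal{C}$ of homothetic copies of $K$ (sets $v+\lambda K$ with $v\in\mathbb{R}^d$, $\lambda>0$) admits a sub-collection $\mathcal{S}\subseteq\mathcal{C}$ of pairwise disjoint sets with $|\bigcup_{K'\in\mathcal{S}}K'|\ge c\,|\bigcup_{K'\in\mathcal{C}}K'|$. The constant $f(K)$ is defined in the same way, with $\mathcal{C}$ ranging only over finite collections of translates of $K$. The modulus of convexity is $$\delta_K(\epsilon)=\min\left\{1-\left\lVert \tfrac{x+y}{2}\right\rVert_K : \lVert x\rVert_K,\lVert y\rVert_K\le 1,\ \lVert x-y\rVert_K\ge\epsilon\right\}.$$ The symbol $\log$ is the natural logarithm. *)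

(* Defs.v *)
From HB Require Import structures.
From mathcomp Require Import all_boot all_order all_algebra.
From mathcomp Require Import all_classical all_reals all_analysis.

Set Implicit Arguments.
Unset Strict Implicit.
Unset Printing Implicit Defensive.

Import Order.TTheory GRing.Theory Num.Theory.
Import numFieldNormedType.Exports.

Local Open Scope classical_set_scope.
Local Open Scope ring_scope.

Section lebesgue_tuple.
Context {R : realType}.
Local Open Scope ereal_scope.

Definition tuple_cons n (p : R * n.-tuple R) : n.+1.-tuple R :=
  [tuple of p.1 :: p.2].

Lemma measurable_tuple_cons n :
  measurable_fun [set: R * n.-tuple R] (@tuple_cons n).
Proof. exact: measurable_cons. Qed.

Section step.
Variables (n : nat) (m : {sigma_finite_measure set (n.-tuple R) -> \bar R}).

Definition lebesgue_cons : set (n.+1.-tuple R) -> \bar R :=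
  pushforward (@lebesgue_measure R \x m) (@tuple_cons n).

Let lebesgue_cons0 : lebesgue_cons set0 = 0.
Proof. by rewrite /lebesgue_cons /pushforward preimage_set0 measure0. Qed.

Let lebesgue_cons_ge0 A : 0 <= lebesgue_cons A.
Proof. by apply: integral_ge0 => x _; exact: measure_ge0. Qed.

Let lebesgue_cons_sigma_additive : semi_sigma_additive lebesgue_cons.
Proof.
move=> F mF tF mUF; rewrite /lebesgue_cons /pushforward preimage_bigcup.
apply: measure_semi_sigma_additive.
- by move=> n'; rewrite -[X in measurable X]setTI; exact: measurable_tuple_cons.
- apply/trivIsetP => /= i j _ _ ij; rewrite -preimage_setI.
  by move/trivIsetP : tF => /(_ _ _ _ _ ij) ->//; rewrite preimage_set0.
- rewrite -preimage_bigcup -[X in measurable X]setTI.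
  exact: measurable_tuple_cons.
Qed.

HB.instance Definition _ := isMeasure.Build _ _ _ lebesgue_cons
  lebesgue_cons0 lebesgue_cons_ge0 lebesgue_cons_sigma_additive.

Let lebesgue_cons_sigma_finite : sigma_finite setT lebesgue_cons.
Proof.
have /sigma_finiteP[F [TF ndF Foo]] := sigma_finiteT (@lebesgue_measure R).
have /sigma_finiteP[G [TG ndG Goo]] := sigma_finiteT m.
pose g (t : n.+1.-tuple R) : measurableTypeR R * n.-tuple R :=
  (tnth t ord0, [tuple of behead t]).
have mg : measurable_fun setT g.
  by apply: measurable_fun_pair; [exact: measurable_tnth|exact: measurable_behead].
have gK : cancel (@tuple_cons n) g.
  by case=> x t; congr pair; apply: val_inj.
exists (fun k => g @^-1` (F k `*` G k)).
  apply/esym/seteqP; split=> // t _.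
  have : [set: measurableTypeR R] (g t).1 by [].
  have : [set: n.-tuple R] (g t).2 by [].
  rewrite TF TG => -[j _ Gj] [i _ Fi].
  exists (maxn i j) => //; split.
  - by move: Fi; exact/subsetPset/ndF/leq_maxl.
  - by move: Gj; exact/subsetPset/ndG/leq_maxr.
move=> k; have [mF Fk] := Foo k; have [mG Gk] := Goo k; split.
  by rewrite -[X in measurable X]setTI; apply: mg => //; exact: measurableX.
rewrite /lebesgue_cons /pushforward -comp_preimage.
rewrite (_ : g \o _ = id); last by apply/funext => p; exact: gK.
by rewrite preimage_id product_measure1E// lte_mul_pinfty// ge0_fin_numE.
Qed.

HB.instance Definition _ :=
  Measure_isSigmaFinite.Build _ _ _ lebesgue_cons lebesgue_cons_sigma_finite.

End step.

(* The d-fold product of the Lebesgue measure of R, on the product (that is,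
   Borel) sigma-algebra of d.-tuple R. *)
Fixpoint lebesgue_tuple n : {sigma_finite_measure set (n.-tuple R) -> \bar R} :=
  match n with
  | 0%N => \d_([tuple] : 0.-tuple R)
  | n'.+1 => lebesgue_cons (lebesgue_tuple n')
  end.

Lemma lebesgue_tuple_prod n (A : 'I_n -> set R) :
  (forall i, measurable (A i)) ->
  lebesgue_tuple n [set t | forall i, A i (tnth t i)] =
  \prod_(i < n) (lebesgue_measure (A i)).
Proof.
elim: n A => [|n IH] A mA.
  rewrite big_ord0 /= diracE mem_set//= => -[]//.
pose B := [set t : n.-tuple R | forall i, A (lift ord0 i) (tnth t i)].
have mB : measurable B.
  rewrite (_ : B = \bigcap_(i in [set: 'I_n])
      (fun t : n.-tuple R => tnth t i) @^-1` A (lift ord0 i)); last first.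
    by apply/seteqP; split=> t At i => [_|]; [exact: At|exact: (At i I)].
  apply: fin_bigcap_measurable => // i _; rewrite -[X in measurable X]setTI.
  exact: measurable_tnth.
rewrite big_ord_recl -IH// -/B -product_measure1E//; last exact: mA.
rewrite /= /lebesgue_cons /pushforward.
congr (_ _); apply/seteqP; split=> -[x t]/=.
  move=> At; split=> [|i]; first exact: (At ord0).
  by have := At (lift ord0 i); rewrite tnthS.
case=> Ax At i; case: (unliftP ord0 i) => [j|] ->//.
by rewrite tnthS; exact: At.
Qed.

End lebesgue_tuple.

Section convex_body.
Context {R : realType} {d : nat}.
Implicit Types (K A : set 'rV[R]_d) (C S : set (set 'rV[R]_d)).

(* Lebesgue measure on Borel sets, transported along row vectors ~ tuples. It
   is only applied to finite unions of compact sets. *)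
Definition lebesgue_rV A : \bar R :=
  lebesgue_tuple d [set t | A (\row_i tnth t i)].

Lemma lebesgue_rV_box (a b : 'rV[R]_d) : (forall i, a 0 i <= b 0 i) ->
  lebesgue_rV [set v | forall i, a 0 i <= v 0 i <= b 0 i] =
  (\prod_(i < d) (b 0 i - a 0 i))%:E.
Proof.
move=> ab; rewrite -prodEFin /lebesgue_rV.
rewrite (_ : [set t | _] =
    [set t | forall i, [set` `[a 0 i, b 0 i]] (tnth t i)]); last first.
  by apply/seteqP; split=> t /= tab i; have := tab i; rewrite mxE in_itv.
rewrite (lebesgue_tuple_prod (A := fun i => [set` `[a 0 i, b 0 i]]))//.
apply: eq_bigr => i _.
rewrite lebesgue_measure_itv/= lte_fin; have := ab i.
by rewrite le_eqVlt => /predU1P[->|->]; rewrite ?ltxx ?subrr.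
Qed.

Definition symmetric_convex_body K :=
  [/\ compact K, convex_set (K : set (convex_lmodType 'rV[R]_d)),
      interior K !=set0 & forall x, K x -> K (- x)].

(* The norm with closed unit ball K, as the Minkowski functional of K. *)
Definition body_norm K (x : 'rV[R]_d) : R :=
  inf [set l : R | 0 < l /\ exists2 y, K y & x = l *: y].

(* The infimum is a minimum, by compactness, when K is a symmetric convex body,
   0 < d and eps <= 2; for other values inf is a total-function convention. *)
Definition modulus_of_convexity K (eps : R) : R :=
  inf [set r : R | exists x y : 'rV[R]_d,
    [/\ body_norm K x <= 1, body_norm K y <= 1, eps <= body_norm K (x - y) &
        r = 1 - body_norm K (2^-1 *: (x + y))]].

Definition homothets K : set (set 'rV[R]_d) :=
  [set A | exists (v : 'rV[R]_d) (l : R),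
    0 < l /\ A = [set v + l *: x | x in K]].

Definition translates K : set (set 'rV[R]_d) :=
  [set A | exists v : 'rV[R]_d, A = [set v + x | x in K]].

Definition disjoint_fraction (H : set (set 'rV[R]_d)) (c : R) :=
  forall C, finite_set C -> C `<=` H ->
    exists S, [/\ S `<=` C, trivIset S id &
      (c%:E * lebesgue_rV (\bigcup_(A in C) A)
         <= lebesgue_rV (\bigcup_(A in S) A))%E].

(* For H nonempty of sets of positive finite volume the supremum is a maximum:
   each finite C has finitely many sub-collections, and C = [set A] forces
   c <= 1. *)
Definition disjoint_constant (H : set (set 'rV[R]_d)) : R :=
  sup [set c : R | 0 <= c /\ disjoint_fraction H c].

Definition F_const K : R := disjoint_constant (homothets K).

Definition f_const K : R := disjoint_constant (translates K).

End convex_body.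

(* Main.v *)
(** Let N be the norm with unit ball K, r = 3 - 2 delta_K(1/2) and
    c = 2^d + r^d.

    Translates. Assign every point y of the union U to one center v(y) with
    N (y - v(y)) <= 1. The average over y in U of the measure of
    { y' in U | N (v(y) - v(y')) <= 2 } is at most c |K|: the y' with
    N (y' - v(y)) <= r contribute at most r^d |K| for each y, and if
    N (y' - v(y)) > r, then by uniform convexity v(y) is within distance 1 of
    v(y') - 2 (y' - v(y')), so for fixed y' these y lie in one ball of radius 2
    and have measure at most 2^d |K|. Hence some center v can be selected at the
    cost of removing at most c |K| from the union together with all the centers
    within distance 2 of v; iterate.

    Homothets. Split the radii into the classes [rho^j, rho^(j+1)[ with
    rho = 1 + 1/d, and keep the classes of one residue of j modulo d + 1, which
    loses a factor d + 1. Two kept classes differ by a factor at least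
    rho^d >= 2. Treating the classes from the largest radii down, enlarging
    within a class to a common radius loses a factor rho^d <= e, and the smaller
    balls touching a selected ball lie in its double, so they cost another
    2^d <= c. This gives F(K) >= ((d + 1) (e + 1) c)^-1, which is stronger than
    the claimed bound; eps d = 2 (e + 1) / ln d absorbs the difference. *)
Require Import Defs.
From HB Require Import structures.
From mathcomp Require Import all_boot all_order all_algebra.
From mathcomp Require Import all_classical all_reals all_analysis.
From mathcomp Require Import measurable_realfun.
From mathcomp Require Import ring lra zify.

Set Implicit Arguments.
Unset Strict Implicit.
Unset Printing Implicit Defensive.

Import Order.TTheory GRing.Theory Num.Theory.
Import numFieldNormedType.Exports.

Local Open Scope classical_set_scope.
Local Open Scope ring_scope.

(** * The norm with unit ball [K], and its modulus of convexity at 1/2 *)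

Section gauge.
Context {R : realType} {d : nat} (K : set 'rV[R]_d).
Hypothesis cbK : symmetric_convex_body K.
Implicit Types x y : 'rV[R]_d.

Lemma body_opp x : K x -> K (- x).
Proof. by case: cbK => _ _ _; exact. Qed.

Lemma body_closed : closed K.
Proof. by case: cbK => /compact_closed + _ _ _; apply; exact: norm_hausdorff. Qed.

Lemma body_combination (a b : R) x y : 0 <= a -> 0 <= b -> a + b = 1 ->
  K x -> K y -> K (a *: x + b *: y).
Proof.
case: cbK => _ convK _ _ a0 b0 ab Kx Ky.
have a1 : a <= 1 by lra.
have := convK x y (Itv01 a0 a1); rewrite !inE/= => /(_ Kx Ky).
have -> : b = 1 - a by lra.
exact.
Qed.

(** If [K] contains the ball of radius [e] about [x0], then by symmetry it contains the ball about
    [- x0], and [x] is the midpoint of [x0 + x] and [- (x0 - x)]. *)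
Lemma body_ball : exists2 e : R, 0 < e & forall x, `|x| < e -> K x.
Proof.
case: cbK => _ _ [x0 /nbhs_ballP[e/= e0 x0e]] _; exists e => // x xe.
have K1 : K (x0 + x).
  by apply: x0e; rewrite -ball_normE/= opprD addrA subrr add0r normrN.
have K2 : K (- (x0 - x)).
  by apply/body_opp/x0e; rewrite -ball_normE/= opprB addrC subrK.
rewrite (_ : x = 2^-1 *: (x0 + x) + 2^-1 *: - (x0 - x)).
  by apply: body_combination => //; lra.
by apply/rowP => i; rewrite !mxE; lra.
Qed.

Lemma body0 : K 0.
Proof. by have [e e0] := body_ball; apply; rewrite normr0. Qed.

Lemma body_scale (a : R) x : 0 <= a <= 1 -> K x -> K (a *: x).
Proof.
move=> /andP[a0 a1] Kx; rewrite -[_ *: _]addr0 -[0](scaler0 _ (1 - a)).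
by apply: body_combination => //; [lra|lra|exact: body0].
Qed.

Let gauges x := [set l : R | 0 < l /\ exists2 y, K y & x = l *: y].

Let gauges_scale x (l : R) : 0 < l -> gauges x l <-> K (l^-1 *: x).
Proof.
move=> l0; split=> [[_ [y Ky ->]]|Kx].
  by rewrite scalerA mulVf ?gt_eqF// scale1r.
by split=> //; exists (l^-1 *: x) => //; rewrite scalerA mulfV ?gt_eqF// scale1r.
Qed.

Let gauges_lbound x : has_lbound (gauges x).
Proof. by exists 0 => l [/ltW]. Qed.

Let gauges_nonempty x : gauges x !=set0.
Proof.
have [e e0 eK] := body_ball.
exists (2 * (`|x| + 1) / e); have l0 : 0 < 2 * (`|x| + 1) / e.
  by rewrite divr_gt0// mulr_gt0// ltr_wpDl.
apply/gauges_scale => //; apply: eK; rewrite normrZ gtr0_norm ?invr_gt0//.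
have x0 := normr_ge0 x.
by rewrite mulrC ltr_pdivrMr// mulrCA divff ?gt_eqF// mulr1; lra.
Qed.

Lemma body_norm_ge0 x : 0 <= body_norm K x.
Proof. by apply: lb_le_inf; [exact: gauges_nonempty|move=> l [/ltW]]. Qed.

(** The infimum defining the norm is attained because [K] is closed. Through this equivalence, norm
    inequalities become membership in [K]. *)
Lemma body_norm_le (r : R) x : 0 < r -> body_norm K x <= r <-> K (r^-1 *: x).
Proof.
move=> r0; split=> [xr|Krx]; last first.
  by apply: ge_inf; [exact: gauges_lbound|exact/(gauges_scale x r0)].
(* The sequence [u] lies strictly above the infimum and tends to [r], so [x] divided by [u n] is in
   [K] and closedness gives the limit. *)
pose u := fun n : nat => r + r * @harmonic R n.
have u0 n : r < u n by rewrite /u ltrDl mulr_gt0// harmonic_gt0.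
have Ku n : K ((u n)^-1 *: x).
  have [|l Lx lu] := inf_lt (gauges_nonempty x) (x := u n).
    exact: le_lt_trans (u0 n).
  have l0 : 0 < l by case: Lx.
  have un0 : 0 < u n by exact: lt_trans (u0 n).
  rewrite (_ : _ *: _ = (l / u n) *: (l^-1 *: x)).
    apply: body_scale; last exact/gauges_scale.
    by apply/andP; split; [rewrite divr_ge0// ltW|rewrite ler_pdivrMr// mul1r ltW].
  by rewrite scalerA mulrAC divff ?gt_eqF// mul1r.
apply: (@closed_cvg _ _ \oo _ (fun n => (u n)^-1 *: x) K body_closed).
  by near=> n; exact: Ku.
apply: cvgZr_tmp; apply: cvgV; first by rewrite gt_eqF.
rewrite -[X in _ --> X]addr0; apply: cvgD; first exact: cvg_cst.
rewrite -[X in _ --> X](mulr0 r); apply: cvgMl_tmp; exact: cvg_harmonic.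
Unshelve. all: by end_near. Qed.

(** For [r] and [s] slightly above the two norms, [x + y] over [r + s] is a convex combination of
    [x / r] and [y / s]. The slack [e] keeps [r] and [s] positive. *)
Lemma body_norm_triangle x y :
  body_norm K (x + y) <= body_norm K x + body_norm K y.
Proof.
apply/ler_addgt0Pr => e e0.
set a := body_norm K x; set b := body_norm K y.
have a0 : 0 <= a := body_norm_ge0 x; have b0 : 0 <= b := body_norm_ge0 y.
pose r := a + e / 2; pose s := b + e / 2.
have r0 : 0 < r by rewrite ltr_wpDl// divr_gt0.
have s0 : 0 < s by rewrite ltr_wpDl// divr_gt0.
rewrite (_ : a + b + e = r + s); last by rewrite /r /s; field.
apply/body_norm_le; first exact: addr_gt0.
have Kx : K (r^-1 *: x) by apply/body_norm_le => //; rewrite -/a lerDl divr_ge0 ?ltW.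
have Ky : K (s^-1 *: y) by apply/body_norm_le => //; rewrite -/b lerDl divr_ge0 ?ltW.
rewrite (_ : _ *: _ = (r / (r + s)) *: (r^-1 *: x) + (s / (r + s)) *: (s^-1 *: y)).
  have rs : 0 <= r + s by lra.
  apply: body_combination => //; [by rewrite divr_ge0// ltW..|].
  by rewrite -mulrDl divff// gt_eqF// addr_gt0.
have cancel a' : 0 < a' -> a' / (r + s) * a'^-1 = (r + s)^-1.
  by move=> a'0; rewrite mulrAC divff ?gt_eqF// mul1r.
by rewrite !scalerA !cancel// -scalerDr.
Qed.

Lemma body_normN x : body_norm K (- x) = body_norm K x.
Proof.
rewrite /body_norm; congr inf; apply/seteqP; split=> l [l0 [y Ky xy]].
  by split=> //; exists (- y); [exact: body_opp|rewrite scalerN -xy opprK].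
by split=> //; exists (- y); [exact: body_opp|rewrite scalerN xy].
Qed.

Lemma body_norm_dist x y : body_norm K (x - y) = body_norm K (y - x).
Proof. by rewrite -body_normN opprB. Qed.

Lemma body_normZ (a : R) x : 0 < a -> body_norm K (a *: x) = a * body_norm K x.
Proof.
have le_scale c y : 0 < c -> body_norm K (c *: y) <= c * body_norm K y.
  move=> c0; apply/ler_addgt0Pr => e e0.
  have y0 := body_norm_ge0 y; have ec : 0 < e / c by exact: divr_gt0.
  rewrite (_ : _ + e = c * (body_norm K y + e / c)); last first.
    by field; rewrite gt_eqF.
  have ye : 0 < body_norm K y + e / c by lra.
  apply/body_norm_le; first exact: mulr_gt0.
  rewrite scalerA invfM mulrAC mulVf ?gt_eqF// mul1r.
  by apply/body_norm_le => //; rewrite lerDl ltW.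
(* The reverse inequality is [le_scale] for the factor [a^-1] and the vector [a *: x]. *)
move=> a0; apply/le_anti; rewrite le_scale//= mulrC -ler_pdivlMr// mulrC.
rewrite -[in leLHS](scale1r x) -(mulVf (lt0r_neq0 a0)) -scalerA.
by apply: le_scale; rewrite invr_gt0.
Qed.

Let delta := modulus_of_convexity K (1 / 2).

Lemma modulus_le1 : delta <= 1.
Proof.
rewrite /delta /modulus_of_convexity; set S := (X in inf X).
(* In dimension 0 no two points are at distance 1/2; the infimum of the empty set is then 0 by
   convention. *)
have [->|/set0P[r Sr]] := eqVneq S set0; first by rewrite inf0.
apply: (@le_trans _ _ r); last first.
  by case: Sr => x [y [_ _ _ ->]]; rewrite gerBl body_norm_ge0.
apply: ge_inf => //; exists 0 => _ [x [y [x1 y1 _ ->]]].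
by rewrite subr_ge0 body_normZ//; have := body_norm_triangle x y; lra.
Qed.

Lemma modulus_midpoint x y : body_norm K x <= 1 -> body_norm K y <= 1 ->
  1 / 2 <= body_norm K (x - y) -> body_norm K (2^-1 *: (x + y)) <= 1 - delta.
Proof.
move=> x1 y1 xy; rewrite lerBrDr addrC -lerBrDr; apply: ge_inf; last by exists x, y.
exists 0 => _ [x' [y' [x1' y1' _ ->]]].
by rewrite subr_ge0 body_normZ//; have := body_norm_triangle x' y'; lra.
Qed.

End gauge.

(** * Lebesgue measure under scaling and translation *)

Section scaled_image.
Context d1 d2 (T1 : measurableType d1) (T2 : measurableType d2) (R : realType).

(** Packaged as a measure, so that the uniqueness theorems for Lebesgue and product measures apply
    to it. *)
Definition scaled_image (c : {nonneg R}) (m : {measure set T1 -> \bar R})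
  (f : T1 -> T2) (mf : measurable_fun setT f) : {measure set T2 -> \bar R} :=
  mscale c (measure_function_pushforward__canonical__measure_function_Measure m mf).

End scaled_image.

Section lebesgue_affine.
Context {R : realType}.
Local Open Scope ereal_scope.
Local Notation lebesgue := (@lebesgue_measure R).

Lemma measurable_affine (c v : R) :
  measurable_fun [set: measurableTypeR R]
    ((fun x => c * x + v)%R : measurableTypeR R -> measurableTypeR R).
Proof. by apply: measurable_funD => //; apply: measurable_funM. Qed.

(** The right-hand side is a measure in [A] with the same value as Lebesgue measure on half-open
    intervals, hence equal to it. *)
Lemma lebesgue_measure_affine (c v : R) (A : set (measurableTypeR R)) :
  (0 < c)%R -> measurable A ->
  lebesgue A = c%:E * lebesgue ((fun x => c * x + v)%R @^-1` A).
Proof.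
move=> c0 mA.
pose nu := scaled_image (NngNum (ltW c0)) lebesgue (measurable_affine c v).
apply: (lebesgue_measure_unique (mu := nu)) => // _ [[a b] _ <-].
rewrite /nu /scaled_image/= /mscale/= /pushforward.
rewrite (_ : _ @^-1` _ = [set` `](a - v) / c, (b - v) / c]%R]); last first.
  apply/seteqP; split=> x /=; rewrite !in_itv/= ltr_pdivrMr// ler_pdivlMr//;
   by rewrite ltrBlDr lerBrDr (mulrC x).
rewrite !lebesgue_measure_itv/= !lte_fin ltr_pM2r ?invr_gt0// ltrD2r.
case: ifPn => _; last by rewrite mule0.
by rewrite -!EFinB -EFinM -mulrBl opprB addrA subrK mulrCA divff ?gt_eqF// mulr1.
Qed.

Definition tuple_affine n (c : R) (v : 'I_n -> R) (t : n.-tuple R) :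
  n.-tuple R := [tuple c * tnth t i + v i | i < n]%R.

Lemma measurable_tuple_affine n c (v : 'I_n -> R) :
  measurable_fun setT (tuple_affine c v).
Proof.
apply/measurable_fun_tnthP => i.
rewrite (_ : _ \o _ = (fun x => c * x + v i)%R \o (fun t => tnth t i)); last first.
  by apply/funext => t /=; rewrite tnth_mktuple.
apply: measurableT_comp; [exact: measurable_affine|exact: measurable_tnth].
Qed.

(** Induction on the dimension: the scaled image under [phi] agrees with the product measure on
    rectangles, by the one-dimensional case and the induction hypothesis, so uniqueness of product
    measures applies. *)
Lemma lebesgue_tuple_affine n c (v : 'I_n -> R) (A : set (n.-tuple R)) :
  (0 < c)%R -> measurable A ->
  lebesgue_tuple n A = (c ^+ n)%:E * lebesgue_tuple n (tuple_affine c v @^-1` A).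
Proof.
move=> c0; elim: n v A => [|n IH] v A mA.
  rewrite expr0 mul1e; congr (lebesgue_tuple 0 _).
  by apply/seteqP; split=> t; rewrite [t]tuple0 /= [tuple_affine _ _ _]tuple0.
pose v' i := v (lift ord0 i).
pose phi (p : measurableTypeR R * n.-tuple R) : measurableTypeR R * n.-tuple R :=
  ((c * p.1 + v ord0)%R, tuple_affine c v' p.2).
have mphi : measurable_fun setT phi.
  apply: measurable_fun_pair.
    exact: (measurableT_comp (measurable_affine c (v ord0)) measurable_fst).
  exact: (measurableT_comp (measurable_tuple_affine c v') measurable_snd).
have c1 : (0 <= c ^+ n.+1)%R by rewrite exprn_ge0// ltW.
pose nu := scaled_image (NngNum c1) (lebesgue \x lebesgue_tuple n) mphi.
have mA' : measurable (@tuple_cons R n @^-1` A).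
  by rewrite -[X in measurable X]setTI; exact: measurable_tuple_cons.
transitivity (nu (@tuple_cons R n @^-1` A)).
  apply: (product_measure_unique (m' := nu)) => // B C mB mC.
  rewrite /nu /scaled_image/= /mscale/= /pushforward.
  rewrite (_ : phi @^-1` _ = ((fun x => c * x + v ord0)%R @^-1` B) `*`
    (tuple_affine c v' @^-1` C))//.
  rewrite product_measure1E//; last 2 first.
  - by rewrite -[X in measurable X]setTI; apply: (measurable_affine c (v ord0)).
  - by rewrite -[X in measurable X]setTI; apply: measurable_tuple_affine.
  rewrite (lebesgue_measure_affine (v ord0) c0 mB) (IH v' _ mC).
  by rewrite exprS EFinM muleACA.
rewrite /nu /scaled_image/= /mscale/= /pushforward; congr (_ * _).
rewrite /lebesgue_cons /pushforward; congr (_ _).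
have phiE p : tuple_cons (phi p) = tuple_affine c v (tuple_cons p).
  apply: eq_from_tnth => i; rewrite tnth_mktuple.
  by case: (unliftP ord0 i) => [j|] ->; rewrite ?tnthS ?tnth0//= tnth_mktuple.
by apply/seteqP; split=> p /=; rewrite phiE.
Qed.
End lebesgue_affine.

(** * Measurability of closed sets and boxes of row vectors, read on tuples *)

Lemma ball_rowP (R : realType) n (x y : 'rV[R]_n) (e : R) : 0 < e ->
  ball x e y <-> forall i, `|x 0 i - y 0 i| < e.
Proof.
move=> e0; split=> [[_ xy] i|xy]; first exact: xy.
by split=> // i j; rewrite ord1; exact: xy.
Qed.

(** The complement is open, hence a union of cubes with rational center and half-side, of which
    there are countably many. This links the topology of row vectors to the product sigma-algebra of
    tuples. *)
Lemma measurable_closed_row (R : realType) n (A : set 'rV[R]_n) : closed A ->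
  measurable [set t : n.-tuple R | A (\row_i tnth t i)].
Proof.
move=> cA; rewrite -[X in measurable X]setCK; apply: measurableC.
set O := ~` _.
pose box (q : n.-tuple rat * rat) := [set t : n.-tuple R |
  forall i, [set x | `|x - ratr (tnth q.1 i)| < ratr q.2] (tnth t i)].
have mbox q : measurable (box q).
  rewrite (_ : box q = \bigcap_(i in [set: 'I_n]) (fun t : n.-tuple R => tnth t i)
      @^-1` [set` `]ratr (tnth q.1 i) - ratr q.2, ratr (tnth q.1 i) + ratr q.2[ ]).
    apply: fin_bigcap_measurable => // i _; rewrite -[X in measurable X]setTI.
    by apply: measurable_tnth => //; exact: measurable_itv.
  apply/seteqP; split=> t tq i => [_|]; have := tq i; rewrite /= in_itv/= ltr_distl//.
  exact.
rewrite (_ : O = \bigcup_q (if `[< box q `<=` O >] then box q else set0)).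
  apply: countable_bigcupT_measurable => [|q]; first exact: countableP.
  by case: ifP.
apply/seteqP; split=> [t Ot|t [q _]]; last by case: ifPn => // /asboolP; exact.
have : nbhs (\row_i tnth t i) (~` A) by apply: open_nbhs_nbhs; split=> //; exact: closed_openC.
case/nbhs_ballP=> e /= e0 teA.
(* A half-side below [e / 2] makes any cube of this size that contains [t] lie within [e] of [t]. *)
have [r] := @rat_in_itvoo R 0 (e / 2) (divr_gt0 e0 (ltr0Sn _ _)).
rewrite in_itv/= => /andP[r0 re].
have [q tq] : {q : n.-tuple rat | forall i, `|tnth t i - ratr (tnth q i)| < ratr r}.
  have [f tf] : {f : 'I_n -> rat & forall i, `|tnth t i - ratr (f i)| < ratr r}.
    apply: (@choice _ _ (fun i (x : rat) => is_true (`|tnth t i - ratr x| < ratr r))) => i.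
    have [x] := @rat_in_itvoo R (tnth t i - ratr r) (tnth t i + ratr r) ltac:(lra).
    rewrite in_itv/= => /andP[x1 x2]; exists x; rewrite ltr_norml; lra.
  by exists [tuple f i | i < n] => i; rewrite tnth_mktuple.
exists (q, r) => //; case: ifPn => [_ //|/asboolP[]].
move=> s /= sq As; apply: (teA _ _ As).
apply/ball_rowP => // i; rewrite !mxE.
rewrite (le_lt_trans (ler_distD (ratr (tnth q i)) _ _))//.
by have := tq i; have := sq i; rewrite /= (distrC (tnth s i)); lra.
Qed.

Lemma measurable_row_box (R : realType) n (a b : 'rV[R]_n) :
  measurable [set t : n.-tuple R |
    forall i, a 0 i <= (\row_j tnth t j) 0 i <= b 0 i].
Proof.
rewrite (_ : [set t | _] = \bigcap_(i in [set: 'I_n])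
    (fun t : n.-tuple R => tnth t i) @^-1` [set` `[a 0 i, b 0 i]]).
  apply: fin_bigcap_measurable => // i _; rewrite -[X in measurable X]setTI.
  by apply: measurable_tnth => //; exact: measurable_itv.
apply/seteqP; split=> t /= tab i => [_|]; have := tab i; rewrite /= in_itv/= mxE//.
exact.
Qed.

(** * Volumes of balls of the norm *)

Section body_measure.
Context {R : realType} {d : nat} (K : set 'rV[R]_d).
Hypothesis cbK : symmetric_convex_body K.
Local Notation mu := (@lebesgue_tuple R d).

Definition body_ball_at (v : 'rV[R]_d) (r : R) : set (d.-tuple R) :=
  [set t | body_norm K (\row_i tnth t i - v) <= r].

Let body_tuples := [set t : d.-tuple R | K (\row_i tnth t i)].

Let measurable_body_tuples : measurable body_tuples.
Proof. exact: (measurable_closed_row (body_closed cbK)). Qed.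

(** As a preimage of [K] under an affine map, the ball is measurable and its measure is given by
    [lebesgue_tuple_affine]. *)
Let body_ball_at_affine v (r : R) : 0 < r -> body_ball_at v r =
  tuple_affine r^-1 (fun i => - (r^-1 * v 0 i)) @^-1` body_tuples.
Proof.
move=> r0; apply/seteqP.
have E t : \row_i tnth (tuple_affine r^-1 (fun i => - (r^-1 * v 0 i)) t) i =
    r^-1 *: (\row_i tnth t i - v).
  by apply/rowP => i; rewrite !mxE tnth_mktuple mulrBr.
by split=> t /=; rewrite /body_ball_at /body_tuples/= E body_norm_le.
Qed.

Lemma measurable_body_ball_at v (r : R) : 0 < r -> measurable (body_ball_at v r).
Proof.
move=> r0; rewrite body_ball_at_affine// -[X in measurable X]setTI.
exact: measurable_tuple_affine.
Qed.

Definition body_volume : R := fine (lebesgue_rV K).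

Let lebesgue_rV_body_lt_pinfty : (lebesgue_rV K < +oo)%E.
Proof.
case: cbK => /compact_bounded[M0 [_ M0K]] _ _ _.
pose M := `|M0| + 1; have M1 : 0 < M by rewrite ltr_wpDl.
have KM x : K x -> forall i, - M <= x 0 i <= M.
  move=> Kx i; have xM : `|x| <= M by apply: (M0K M) => //; rewrite /M (le_lt_trans (ler_norm _))// ltrDl.
  rewrite -ler_norml; apply: le_trans xM.
  (* If a coordinate exceeded the norm of [x], then [x] would lie in the open ball about 0 whose
     radius is that coordinate's absolute value, where all coordinates are strictly smaller. *)
  rewrite leNgt; apply/negP => xi.
  have xi0 : 0 < `|x 0 i| by exact: le_lt_trans xi.
  have : ball (0 : 'rV[R]_d) `|x 0 i| x by rewrite -ball_normE/= sub0r normrN.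
  by move/ball_rowP => /(_ xi0 i); rewrite mxE sub0r normrN ltxx.
have := @lebesgue_rV_box R d (const_mx (- M)) (const_mx M).
move=> boxE; have {boxE} := boxE; set box := [set _ | _] => boxE.
apply: (@le_lt_trans _ _ (lebesgue_rV box)).
  apply: le_measure; rewrite ?inE.
  - exact: measurable_body_tuples.
  - exact: measurable_row_box.
  - by move=> t /= Kt i; rewrite !mxE; have := KM _ Kt i; rewrite mxE.
by rewrite boxE ?ltry// => i; rewrite !mxE; lra.
Qed.

Let lebesgue_rV_body_gt0 : (0 < lebesgue_rV K)%E.
Proof.
have [e e0 eK] := body_ball cbK.
apply: (@lt_le_trans _ _ (lebesgue_rV [set v : 'rV[R]_d | forall i,
    (const_mx (- (e / 2)) : 'rV[R]_d) 0 i <= v 0 i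
      <= (const_mx (e / 2) : 'rV[R]_d) 0 i])).
  rewrite lebesgue_rV_box => [|i]; last by rewrite !mxE; lra.
  by rewrite lte_fin; apply: prodr_gt0 => i _; rewrite !mxE; lra.
apply: le_measure; rewrite ?inE.
- exact: measurable_row_box.
- exact: measurable_body_tuples.
move=> t /= te; apply: eK.
have : ball (0 : 'rV[R]_d) e (\row_i tnth t i).
  apply/ball_rowP => // i; have := te i; rewrite !mxE sub0r normrN ltr_norml; lra.
by rewrite -ball_normE/= sub0r normrN.
Qed.

Lemma lebesgue_rV_body : lebesgue_rV K = body_volume%:E.
Proof. by rewrite /body_volume fineK// ge0_fin_numE// measure_ge0. Qed.

Lemma body_volume_gt0 : 0 < body_volume.
Proof. by rewrite -lte_fin -lebesgue_rV_body. Qed.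

Lemma measure_body_ball_at v (r : R) : 0 < r ->
  mu (body_ball_at v r) = (r ^+ d * body_volume)%:E.
Proof.
move=> r0; have r1 : 0 < r^-1 by rewrite invr_gt0.
rewrite EFinM -lebesgue_rV_body /lebesgue_rV.
rewrite (lebesgue_tuple_affine (fun i => - (r^-1 * v 0 i)) r1 measurable_body_tuples).
rewrite -(body_ball_at_affine v r0) muleA -EFinM exprVn divff ?mul1e//.
by rewrite expf_neq0// gt_eqF.
Qed.

Lemma body_homothetE v (r : R) : 0 < r ->
  [set v + r *: x | x in K] = [set y | body_norm K (y - v) <= r].
Proof.
move=> r0; apply/seteqP; split=> y /=.
  case=> x Kx <-; apply/(body_norm_le cbK _ r0).
  by rewrite addrAC subrr add0r scalerA mulVf ?gt_eqF// scale1r.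
move=> /(body_norm_le cbK _ r0) Ky; exists (r^-1 *: (y - v)) => //.
by rewrite scalerA divff ?gt_eqF// scale1r addrC subrK.
Qed.

End body_measure.

(** * Averaging and double counting for finite families of sets *)

Section averaging.
Context d (T : measurableType d) (R : realType).
Variable mu : {measure set T -> \bar R}.

(** The left-hand side is the integral over [D] of the total weight of the sets [F i] containing the
    point, which is at most [B] everywhere. *)
Lemma weighted_measure_le (I : finType) (P : pred I) (w : I -> R)
    (F : I -> set T) (D : set T) (B : R) :
  (forall i, 0 <= w i) -> (forall i, measurable (F i)) -> measurable D ->
  (forall y, D y -> \sum_(i | P i && (y \in F i)) w i <= B) ->
  (\sum_(i | P i) (w i)%:E * mu (D `&` F i) <= B%:E * mu D)%E.
Proof.
move=> w0 mF mD wB.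
have -> : (\sum_(i | P i) (w i)%:E * mu (D `&` F i) =
    \int[mu]_(y in D) \sum_(i <- enum P) ((w i)%:E * (\1_(F i) y)%:E))%E.
  rewrite ge0_integral_sum//; last 2 first.
  - move=> i; apply: measurable_funeM; apply/measurable_EFinP.
    exact: measurable_indic.
  - by move=> i y _; rewrite -EFinM lee_fin mulr_ge0.
  rewrite big_enum_cond/=; apply: eq_big => [i|i _]; first by rewrite andbT.
  rewrite ge0_integralZl_EFin//; first by rewrite integral_indic// setIC.
  apply/measurable_EFinP; exact: measurable_indic.
rewrite -integral_cst//; apply: ge0_le_integral => //.
- by move=> y _; apply: sume_ge0 => i _; rewrite -EFinM lee_fin mulr_ge0.
- apply: emeasurable_sum => i; apply: measurable_funeM; apply/measurable_EFinP.
  exact: measurable_indic.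
move=> y Dy; under eq_bigr do rewrite -EFinM.
rewrite sumEFin lee_fin; apply: le_trans (wB _ Dy).
rewrite big_enum_cond/= [leRHS]big_mkcondr/= le_eqVlt; apply/orP; left.
apply/eqP/eq_big => [i|i _]; first by rewrite andbT.
by rewrite indicE; case: ifP; rewrite ?mulr1 ?mulr0.
Qed.

(** The mean, with weights [w i], of the adjacent weight of [i] is at most [A + B]. Each [D j] is
    cut by [E i]: the inner parts are summed for fixed [i] against [A], the outer parts for fixed
    [j] against [B]. *)
Lemma averaging n (D E : 'I_n -> set T) (adj : rel 'I_n) (w : 'I_n -> R)
    (A B : R) :
  (0 < n)%N -> (forall i, measurable (D i)) -> (forall i, measurable (E i)) ->
  (forall i, mu (D i) = (w i)%:E) -> 0 <= A -> 0 <= B ->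
  (forall i, (\sum_(j | adj i j) mu (D j `&` E i) <= A%:E)%E) ->
  (forall j y, D j y -> \sum_(i | adj i j && (y \notin E i)) w i <= B) ->
  exists i, \sum_(j | adj i j) w j <= A + B.
Proof.
move=> n0 mD mE muD A0 B0 hA hB.
have w0 i : 0 <= w i by rewrite -lee_fin -muD.
have le_key : \sum_i w i * (\sum_(j | adj i j) w j) <= \sum_i w i * (A + B).
  rewrite -lee_fin -!sumEFin.
  have -> : (\sum_i (w i * \sum_(j | adj i j) w j)%:E =
     \sum_i (w i)%:E * (\sum_(j | adj i j) mu (D j `&` E i)) +
     \sum_j (\sum_(i | adj i j) (w i)%:E * mu (D j `&` ~` E i)))%E.
    rewrite [X in (_ + X)%E](exchange_big_dep predT)//= -big_split/=.
    apply: eq_bigr => i _; rewrite EFinM -sumEFin !ge0_sume_distrr//.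
    rewrite -big_split/=; apply: eq_bigr => j _.
    rewrite -ge0_muleDr//; congr (_ * _)%E.
    by rewrite -muD addeC -setDE; exact: measureDI.
  by move=> j _; rewrite lee_fin.
  under [leRHS]eq_bigr do rewrite mulrDr EFinD.
  rewrite big_split/=; apply: leeD; apply: lee_sum => i _.
    by rewrite EFinM; apply: lee_wpmul2l; rewrite ?lee_fin.
  rewrite mulrC EFinM -muD; apply: weighted_measure_le => //.
    by move=> j; exact: measurableC.
  move=> y Dy; apply: le_trans (hB _ _ Dy); rewrite le_eqVlt; apply/orP; left.
  by apply/eqP/eq_bigl => j; rewrite in_setC.
apply/not_existsP => hn.
have gt_deg i : A + B < \sum_(j | adj i j) w j by rewrite ltNge; apply/negP/hn.
(* Strictness in the mean needs an index of positive weight; if there were none, all adjacent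
   weights would be 0. *)
have [j wj] : exists j, 0 < w j.
  apply/not_existsP => h; have := gt_deg (Ordinal n0).
  rewrite big1 ?ltNge ?addr_ge0// => j _.
  by apply/le_anti; rewrite w0 andbT leNgt; apply/negP/h.
have := le_key; rewrite leNgt => /negP; apply.
rewrite (bigD1 j)//= [ltRHS](bigD1 j)//=; apply: ltr_leD.
  by rewrite ltr_pM2l.
by apply: ler_sum => i _; rewrite ler_wpM2l// ltW.
Qed.

Lemma measure_bigsetU_le (I : Type) (s : seq I) (P : pred I) (F : I -> set T) :
  (forall i, P i -> measurable (F i)) ->
  (mu (\big[setU/set0]_(i <- s | P i) F i) <= \sum_(i <- s | P i) mu (F i))%E.
Proof.
move=> mF; elim: s => [|i s IH]; first by rewrite !big_nil measure0.
rewrite !big_cons; case: ifP => // Pi.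
apply: (le_trans (measureU2 _ (mF _ Pi) _)); last exact: leeD.
by elim/big_ind: _ => //; exact: measurableU.
Qed.

(** This is [weighted_measure_le] with unit weights and [B = 1]: by disjointness a point lies in at
    most one [F i]. *)
Lemma sum_measure_disjoint_le (I : finType) (P : pred I) (F : I -> set T)
    (X : set T) :
  (forall i, measurable (F i)) -> measurable X -> trivIset setT F ->
  (forall i, P i -> F i `<=` X) -> (\sum_(i | P i) mu (F i) <= mu X)%E.
Proof.
move=> mF mX tF FX.
have -> : (\sum_(i | P i) mu (F i) = \sum_(i | P i) 1%:E * mu (X `&` F i))%E.
  by apply: eq_bigr => i Pi; rewrite mul1e setIC setIidl//; exact: FX.
rewrite -[leRHS]mul1e; apply: weighted_measure_le => // y _.
have [[i /andP[Pi yi]]|h] := pselect (exists i, P i && (y \in F i)); last first.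
  by rewrite big_pred0// => i; apply/negP => Pi; apply: h; exists i.
rewrite (big_pred1 i)// => j; apply/idP/eqP => [/andP[_ yj]|->]; last by rewrite Pi.
by apply: tF => //; exists y; split; exact: set_mem.
Qed.

End averaging.

(** * Selecting disjoint balls of a common radius *)

Section translates.
Context {R : realType} {d : nat} (K : set 'rV[R]_d).
Hypothesis cbK : symmetric_convex_body K.
Local Notation mu := (@lebesgue_tuple R d).
Local Notation N := (body_norm K).
Local Notation ball_at := (body_ball_at K).
Local Notation vol := (body_volume K).
Local Notation radius := (3 - 2 * modulus_of_convexity K (1 / 2)).
Local Notation const := (2 ^+ d + radius ^+ d).
Implicit Types (s : seq 'rV[R]_d) (t : R).

Lemma radius_ge1 : 1 <= radius.
Proof. by have := modulus_le1 cbK; lra. Qed.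

Lemma body_norm0 : N 0 = 0.
Proof.
have := body_normZ cbK 0 (ltr0Sn R 1); rewrite scaler0.
by have := body_norm_ge0 cbK 0; lra.
Qed.

(** By contraposition: if [2 *: a - b] has norm above [t], then [a / t] and [b / (2 * t)] are more
    than 1/2 apart in the unit ball, so uniform convexity bounds their midpoint. This is the only
    use of the modulus and the source of [radius]. *)
Lemma far_implies_close (a b : 'rV[R]_d) t : 0 < t ->
  N a <= t -> N b <= 2 * t -> radius * t < N (a + b) -> N (2 *: a - b) <= t.
Proof.
move=> t0 a1 b2; apply: contraTT; rewrite -!ltNge -leNgt => ab.
pose x := t^-1 *: a; pose y := (2 * t)^-1 *: b.
have t'0 : 0 < t^-1 by rewrite invr_gt0.
have t2 : 0 < 2 * t by lra.
have t2' : 0 < (2 * t)^-1 by rewrite invr_gt0.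
have x1 : N x <= 1 by rewrite body_normZ// mulrC ler_pdivrMr// mul1r.
have y1 : N y <= 1 by rewrite body_normZ// mulrC ler_pdivrMr// mul1r.
have xy : 1 / 2 <= N (x - y).
  have -> : x - y = (2 * t)^-1 *: (2 *: a - b).
    apply/rowP => i; rewrite !mxE; field; lra.
  rewrite body_normZ// [leRHS]mulrC ler_pdivlMr//; lra.
have := modulus_midpoint cbK x1 y1 xy.
(* The two terms have norm at most [2 * t * (1 - delta)] and [t], with sum [radius * t]. *)
have -> : a + b = (2 * t) *: (2^-1 *: (x + y)) + t *: y.
  apply/rowP => i; rewrite !mxE; field; lra.
move=> mid; apply: (le_trans (body_norm_triangle cbK _ _)).
rewrite (body_normZ cbK (2^-1 *: (x + y)) t2) (body_normZ cbK y t0).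
have h1 := ler_wpM2l (ltW t2) mid; have h2 := ler_wpM2l (ltW t0) y1.
by lra.
Qed.

Definition union_balls s t := \bigcup_(v in [set` s]) ball_at v t.

Lemma measurable_union_balls s t : 0 < t -> measurable (union_balls s t).
Proof.
by move=> t0; apply: fin_bigcup_measurable => // v _; exact: measurable_body_ball_at.
Qed.

Lemma greedy_center s t : 0 < t -> s != [::] -> exists2 v, v \in s &
  (mu (union_balls s t `\` union_balls [seq u <- s | (2 * t < N (u - v))%R] t)
    <= (const * (t ^+ d * vol))%:E)%E.
Proof.
move=> t0 s0.
have n0 : (0 < size s)%N by rewrite lt0n size_eq0.
pose c i := nth 0 s i; pose F i := ball_at (c i) t.
have mF i : measurable (F i) by exact: measurable_body_ball_at.
(* The assignment of points to centers: [D i] holds the points whose first containing ball is the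
   one of index [i]. *)
pose D (i : 'I_(size s)) := seqDU F i.
have mD i : measurable (D i) by exact: seqDU_measurable.
have tD : trivIset setT D.
  move=> i j _ _ ij; apply/val_inj.
  exact: (@trivIset_seqDU _ F i j I I ij).
have DF i : D i `<=` F i by exact: subset_seqDU.
pose w i := fine (mu (D i)).
have muD i : mu (D i) = (w i)%:E.
  rewrite /w fineK// ge0_fin_numE ?measure_ge0//.
  apply: (@le_lt_trans _ _ (mu (F i))); first by apply: le_measure; rewrite ?inE.
  by rewrite measure_body_ball_at// ltry.
have r0 : 0 < radius by have := radius_ge1; lra.
have vol0 := body_volume_gt0 cbK.
pose adj (i j : 'I_(size s)) := N (c i - c j) <= 2 * t.
have [|||||i hi] := @averaging _ _ _ mu (size s) D (fun i => ball_at (c i) (radius * t))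
    adj w ((radius * t) ^+ d * vol) ((2 * t) ^+ d * vol) n0 mD _ muD.
- by move=> i; apply: measurable_body_ball_at => //; exact: mulr_gt0.
- by rewrite mulr_ge0 ?exprn_ge0 ?mulr_ge0 ?ltW.
- by rewrite mulr_ge0 ?exprn_ge0 ?mulr_ge0 ?ltW.
- move=> i; rewrite -(measure_body_ball_at cbK (c i)) ?mulr_gt0//.
  apply: sum_measure_disjoint_le => //.
  + by move=> j; apply: measurableI => //; apply: measurable_body_ball_at => //; exact: mulr_gt0.
  + by apply: measurable_body_ball_at => //; exact: mulr_gt0.
  + by apply: trivIset_setIr.
(* With [a] the offset of [y] from [c j], every cell [D i] counted here lies in the ball of radius
   [2 * t] about [c j - 2 *: a]: apply [far_implies_close] to [a] and [c j - c i]. *)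
- move=> j y Djy; rewrite -lee_fin -sumEFin.
  under eq_bigr do rewrite -muD.
  pose a := \row_i tnth y i - c j.
  rewrite -(measure_body_ball_at cbK (c j - 2 *: a)) ?mulr_gt0//.
  apply: sum_measure_disjoint_le => //.
    by apply: measurable_body_ball_at => //; exact: mulr_gt0.
  move=> i /andP[adjij]; rewrite notin_setE /body_ball_at/= => /negP; rewrite -ltNge => far z /DF Fz.
  have aj : N a <= t by exact: DF Djy.
  have close : N (2 *: a - (c j - c i)) <= t.
    apply: far_implies_close => //; first by rewrite (body_norm_dist cbK).
    by rewrite /a addrA subrK.
  rewrite /body_ball_at/= (_ : \row_k tnth z k - (c j - 2 *: a) =
      (\row_k tnth z k - c i) + (2 *: a - (c j - c i))); last first.
    by apply/rowP => k; rewrite !mxE; ring.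
  apply: (le_trans (body_norm_triangle cbK _ _)).
  by have : N (\row_i tnth z i - c i) <= t := Fz; lra.
exists (c i); first exact: mem_nth.
(* A removed point lies in some cell [D j]. If [c j] were farther than [2 * t] from [c i], its ball
   would survive the filter and still cover the point. *)
apply: (@le_trans _ _ (mu (\big[setU/set0]_(j | adj i j) D j))).
  apply: le_measure; rewrite ?inE.
  - by apply: measurableD; exact: measurable_union_balls.
  - by elim/big_ind: _ => //; exact: measurableU.
  move=> y [[v /= vs vy] ny].
  have : (\big[setU/set0]_(j < size s) F j) y.
    rewrite -bigcup_mkord; exists (index v s); first by rewrite /= index_mem.
    by rewrite /F /c nth_index.
  rewrite bigsetU_seqDU -bigcup_mkord => -[j /= js Djy].
  have [aij|] := boolP (adj i (Ordinal js)).
    by rewrite (bigD1 (Ordinal js))//=; left.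
  rewrite -ltNge => far; case: ny; exists (c j); last exact: (DF (Ordinal js)).
  by rewrite /= mem_filter mem_nth// (body_norm_dist cbK) far.
apply: (le_trans (measure_bigsetU_le mu (index_enum _) (fun j _ => mD j))).
rewrite (eq_bigr _ (fun j _ => muD j)) sumEFin lee_fin; apply: (le_trans hi).
by rewrite !exprMn -!mulrA -mulrDl addrC.
Qed.
(** Iteration of [greedy_center] on the centers farther than [2 * t] from the chosen one. The chosen
    center is itself discarded, so the list shrinks. *)
Lemma disjoint_translates s t : 0 < t -> exists s', [/\ {subset s' <= s}, uniq s',
  {in s' &, forall u v, u != v -> 2 * t < N (u - v)} &
  (mu (union_balls s t) <= (const * (t ^+ d * vol) * (size s')%:R)%:E)%E].
Proof.
move=> t0; have [n] := ubnP (size s); elim: n s => // n IH s /ltnSE sn.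
have [->|s0] := eqVneq s [::].
  by exists [::]; split=> //; rewrite /union_balls bigcup_seq big_nil measure0 mulr0.
have [v vs hv] := greedy_center t0 s0.
set s2 := [seq _ <- _ | _] in hv.
have [|s' [s's us' sep hs']] := IH s2.
  apply: leq_trans sn; rewrite size_filter -(count_predC (fun u => 2 * t < N (u - v)) s).
  rewrite -[X in (X < _)%N]addn0 ltn_add2l -has_count; apply/hasP; exists v => //=.
  by rewrite subrr body_norm0 -leNgt; lra.
have far u : u \in s' -> 2 * t < N (u - v).
  by move=> /s's; rewrite mem_filter => /andP[].
exists (v :: s'); split.
- move=> u; rewrite inE => /predU1P[->//|/s's].
  by rewrite mem_filter => /andP[].
- rewrite /= us' andbT; apply/negP => /far.
  by rewrite subrr body_norm0; lra.
- move=> u1 u2; rewrite !inE => /predU1P[->|u1s] /predU1P[->|u2s] u12.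
  + by rewrite eqxx in u12.
  + by rewrite (body_norm_dist cbK); exact: far.
  + exact: far.
  + exact: sep.
have mU x : measurable (union_balls x t) by exact: measurable_union_balls.
apply: (@le_trans _ _ (mu (union_balls s t `\` union_balls s2 t) + mu (union_balls s2 t)))%E.
  apply: (le_trans _ (measureU2 _ _ _)) => //; last exact: measurableD.
  apply: le_measure; rewrite ?inE//; first by apply: measurableU => //; exact: measurableD.
  by move=> y Uy; have [?|?] := pselect (union_balls s2 t y); [right|left].
have -> : (size (v :: s'))%:R = 1 + (size s')%:R :> R by rewrite /= -add1n natrD.
by rewrite mulrDr mulr1 EFinD; exact: leeD.
Qed.

End translates.

Lemma exists_argmax (I : eqType) (R : realDomainType) (f : I -> R) (s : seq I) :
  s != [::] -> exists2 x, x \in s & {in s, forall y, f y <= f x}.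
Proof.
elim: s => // a s IH _; have [->|/IH[x xs xm]] := eqVneq s [::].
  by exists a => [|y]; rewrite !inE ?eqxx// => /eqP->.
have [ax|xa] := leP (f a) (f x).
  by exists x => [|y]; rewrite inE ?xs ?orbT// => /predU1P[->|/xm].
exists a => [|y]; rewrite inE ?eqxx// => /predU1P[->//|/xm yx].
exact: le_trans yx (ltW xa).
Qed.

(** * Families of balls of varying radii, encoded as pairs of center and radius *)

Section homothets.
Context {R : realType} {d : nat} (K : set 'rV[R]_d).
Hypothesis cbK : symmetric_convex_body K.
Local Notation mu := (@lebesgue_tuple R d).
Local Notation N := (body_norm K).
Local Notation ball_at := (body_ball_at K).
Local Notation vol := (body_volume K).
Local Notation radius := (3 - 2 * modulus_of_convexity K (1 / 2)).
Local Notation const := (2 ^+ d + radius ^+ d).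
Local Notation rball := ('rV[R]_d * R)%type.
Implicit Types (s : seq rball) (p q : rball).

Definition cover s := \bigcup_(p in [set` s]) ball_at p.1 p.2.

Definition separated s := uniq s /\
  {in s &, forall p q, p != q -> p.2 + q.2 < N (p.1 - q.1)}.

(** Total volume of the balls in units of [vol], counted with multiplicity. *)
Definition mass s := \sum_(p <- s) p.2 ^+ d.

Lemma measurable_cover s : {in s, forall p, 0 < p.2} -> measurable (cover s).
Proof.
by move=> s0; apply: fin_bigcup_measurable => // p /s0; exact: measurable_body_ball_at.
Qed.

Lemma cover_cons p s : cover (p :: s) = ball_at p.1 p.2 `|` cover s.
Proof. by rewrite /cover !bigcup_seq big_cons. Qed.

Lemma measure_cover s : {in s, forall p, 0 < p.2} -> separated s ->
  mu (cover s) = (vol * mass s)%:E.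
Proof.
elim: s => [|p s IH] s0 [us sep].
  by rewrite /cover /mass bigcup_seq !big_nil measure0 mulr0.
have p0 : 0 < p.2 by apply: s0; rewrite mem_head.
have s0' : {in s, forall q, 0 < q.2} by move=> q qs; apply: s0; rewrite inE qs orbT.
move: us; rewrite /= => /andP[ps us].
rewrite cover_cons measureU; last 3 first.
- exact: measurable_body_ball_at.
- exact: measurable_cover.
- apply/seteqP; split=> // t [/= pt [q /= qs qt]].
  have : p.2 + q.2 < N (p.1 - q.1).
    apply: sep; rewrite ?mem_head ?inE ?qs ?orbT//.
    by apply: contraNneq ps => ->.
  rewrite ltNge => /negP; apply.
  rewrite (_ : p.1 - q.1 = (p.1 - \row_i tnth t i) + (\row_i tnth t i - q.1)).
    apply: (le_trans (body_norm_triangle cbK _ _)); apply: lerD => //.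
    by rewrite (body_norm_dist cbK).
  by rewrite addrA subrK.
have sep' : separated s.
  by split=> // q q' qs q's; apply: sep; rewrite inE ?qs ?q's orbT.
apply: (etrans (congr2 _ (measure_body_ball_at cbK p.1 p0) (IH s0' sep'))).
by rewrite /mass big_cons -EFinD mulrDr (mulrC vol (_ ^+ d)).
Qed.

(** The collection consisting of [K] alone shows that admissible constants are at most 1, so the
    supremum is a genuine one. *)
Lemma disjoint_constant_ge (H : set (set 'rV[R]_d)) (c : R) :
  0 <= c -> H K -> disjoint_fraction H c -> c <= disjoint_constant H.
Proof.
move=> c0 HK Hc; apply: ub_le_sup; last by split.
exists 1 => c' [_ /(_ [set K])[|A ->//|S [SK _]]]; first exact: finite_set1.
rewrite bigcup_set1 => h.
have vol0 := body_volume_gt0 cbK.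
suff : c' * vol <= 1 * vol by rewrite ler_pM2r.
rewrite mul1r -lee_fin EFinM -(lebesgue_rV_body cbK); apply: le_trans h _.
have [->|/set0P[A SA]] := eqVneq S set0.
  rewrite bigcup_set0 (lebesgue_rV_body cbK) [leLHS](measure0 mu) lee_fin.
  exact: ltW.
have -> // : \bigcup_(A in S) A = K.
by apply/seteqP; split=> x; [case=> B /SK ->|exists A => //; rewrite (SK _ SA)].
Qed.

(** Passage from collections of sets to lists of balls. The predicate [Q] on radii covers both
    cases: equal to 1 for translates, positive for homothets. *)
Lemma disjoint_fraction_balls (Q : R -> Prop) (c : R) : 0 < c ->
  (forall l, Q l -> 0 < l) ->
  (forall s, {in s, forall p, Q p.2} -> exists s', [/\ {subset s' <= s},
     separated s' & (mu (cover s) <= (c^-1 * (vol * mass s'))%:E)%E]) ->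
  disjoint_fraction
    [set A | exists v l, Q l /\ A = [set v + l *: x | x in K]] c.
Proof.
move=> c0 Q0 hQ C /finite_seqP[sA ->{C}] CH.
pose hom p : set 'rV[R]_d := [set p.1 + p.2 *: x | x in K].
have [f fP] : {f : set 'rV[R]_d -> rball &
    forall A, A \in sA -> Q (f A).2 /\ A = hom (f A)}.
  apply: (@choice _ _ (fun A p => A \in sA -> Q p.2 /\ A = hom p)) => A.
  have [/CH[v [l [Ql AE]]]|nA] := boolP (A \in sA); last by exists (0, 0).
  by exists (v, l).
have [|s' [s's sep hs']] := hQ (map f sA).
  by move=> _ /mapP[A As ->]; case: (fP _ As).
have s'Q p : p \in s' -> exists2 A, A \in sA & p = f A by move/s's/mapP.
have homE p : Q p.2 -> hom p = [set y | N (y - p.1) <= p.2].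
  by move=> Qp; rewrite /hom body_homothetE//; exact: Q0.
exists [set hom p | p in [set` s']].
have s'0 p : p \in s' -> 0 < p.2.
  by move/s'Q => [A As ->]; apply: Q0; case: (fP _ As).
split.
- by move=> _ [p /= /s'Q[A As ->] <-]; case: (fP _ As) => _ <-.
- move=> _ _ [p /= ps <-] [q /= qs <-] [x [px qx]].
  have [->//|pq] := eqVneq p q; exfalso.
  have := sep.2 _ _ ps qs pq; rewrite ltNge => /negP; apply.
  have [[A As pA] [B Bs qB]] := (s'Q _ ps, s'Q _ qs).
  move: px qx; rewrite !homE; last 2 first.
  + by rewrite qB; case: (fP _ Bs).
  + by rewrite pA; case: (fP _ As).
  move=> /= px qx; rewrite -(subrK x p.1) -addrA.
  apply: (le_trans (body_norm_triangle cbK _ _)); apply: lerD => //.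
  by rewrite (body_norm_dist cbK).
have -> : lebesgue_rV (\bigcup_(A in [set` sA]) A) = mu (cover (map f sA)).
  congr (mu _); apply/seteqP; split=> t /=.
    move=> [A /= As At]; have [QA AE] := fP _ As; exists (f A).
      exact: map_f.
    by move: At; rewrite [X in X _]AE homE.
  move=> [_ /= /mapP[A As ->] At]; have [QA AE] := fP _ As; exists A => //.
  by rewrite [X in X _]AE homE.
have -> : lebesgue_rV (\bigcup_(A in [set hom p | p in [set` s']]) A) = mu (cover s').
  congr (mu _); rewrite bigcup_image; apply/seteqP.
  split=> t /= [p /= ps pt]; exists p => //; have [A As pA] := s'Q _ ps;
    by move: pt; rewrite homE// pA; case: (fP _ As).
rewrite (measure_cover s'0 sep).
apply: (@le_trans _ _ (c%:E * (c^-1 * (vol * mass s'))%:E)%E).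
  by apply: lee_wpmul2l hs'; rewrite lee_fin ltW.
by rewrite -EFinM mulrA divff ?mul1r// gt_eqF.
Qed.

Lemma translates_fraction s : {in s, forall p, p.2 = 1} ->
  exists s', [/\ {subset s' <= s}, separated s' &
    (mu (cover s) <= (const * (vol * mass s'))%:E)%E].
Proof.
move=> s1; have [c [cs uc sep hc]] := disjoint_translates cbK (map fst s) (ltr01 (R := R)).
exists [seq (v, 1) | v <- c]; split.
- by move=> _ /mapP[v /cs/mapP[p ps ->] ->]; rewrite -(s1 _ ps) -surjective_pairing.
- split; first by rewrite map_inj_uniq// => u v [].
  move=> _ _ /mapP[u uc' ->] /mapP[v vc ->] uv /=.
  by rewrite -[1 + 1]mulr2n -[1 *+ 2]mulr1 sep//; apply: contraNneq uv => ->.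
have -> : cover s = union_balls K (map fst s) 1.
  apply/seteqP; split=> t [].
    by move=> p /= ps pt; exists p.1; [exact: map_f|rewrite -(s1 _ ps)].
  by move=> _ /= /mapP[p ps ->] pt; exists p => //; rewrite (s1 _ ps).
have -> : mass [seq (v, 1) | v <- c] = (size c)%:R.
  rewrite /mass big_map (eq_bigr (fun=> 1)) => [|v _]; last by rewrite expr1n.
  by rewrite big_const_seq count_predT iter_addr_0.
by move: hc; rewrite expr1n (mul1r vol) -mulrA.
Qed.

(* Within a class the radii agree up to the factor [rho], so all balls may be
   enlarged to a common radius; a ball of a lower class meeting a selected ball
   [q] has at most half the radius of [q], hence lies in the double of [q]. *)
Lemma scale_classes_fraction (rho : R) (j : rball -> int) s : 0 < rho ->
  {in s, forall p, 0 < p.2} ->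
  {in s &, forall p q, j p = j q -> p.2 <= rho * q.2} ->
  {in s &, forall p q, j p < j q -> 2 * p.2 <= q.2} ->
  exists s', [/\ {subset s' <= s}, separated s' &
    (mu (cover s) <= ((const * rho ^+ d + 2 ^+ d) * (vol * mass s'))%:E)%E].
Proof.
move=> rho0; have [n] := ubnP (size s); elim: n s => // n IH s /ltnSE sn s_gt0 same lower.
have [->|s0] := eqVneq s [::].
  exists [::]; split=> //; rewrite /cover /mass bigcup_seq !big_nil measure0.
  by rewrite !mulr0.
have [p0 p0s p0max] := exists_argmax j s0.
pose top := [seq p <- s | j p == j p0].
have top_s p : p \in top -> p \in s by rewrite mem_filter => /andP[].
have p0top : p0 \in top by rewrite mem_filter eqxx.
(* The smallest ball [m] of the top class fixes the common radius [t]: all radii of the class lie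
   between [m.2] and [rho * m.2]. *)
have [|m mtop mmin] := @exists_argmax _ _ (fun p => - p.2) top.
  by apply: contraTneq p0top => ->.
have {}mmin p : p \in top -> m.2 <= p.2 by move/mmin; rewrite lerN2.
have m0 : 0 < m.2 by exact/s_gt0/top_s.
pose t := rho * m.2; have t0 : 0 < t by exact: mulr_gt0.
have top_le p : p \in top -> p.2 <= t.
  move=> ptop; apply: same; [exact: top_s|exact: top_s|].
  by move: ptop mtop; rewrite !mem_filter => /andP[/eqP-> _] /andP[/eqP-> _].
have [c [cs uc sep hc]] := disjoint_translates cbK (map fst top) t0.
(* Selected centers are turned back into balls of [top] with their original radii. These are at most
   [t], so centers more than [2 * t] apart give separated balls. *)
pose g v := nth p0 top (index v (map fst top)).
have gtop v : v \in c -> g v \in top.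
  by move=> /cs vtop; rewrite mem_nth// -(size_map fst) index_mem.
have gK v : v \in c -> (g v).1 = v.
  move=> /cs vtop; rewrite -(nth_map _ v) ?nth_index//.
  by rewrite -(size_map fst) index_mem.
pose s1 := map g c.
have s1top p : p \in s1 -> p \in top by case/mapP => v vc ->; exact: gtop.
have s1_gt0 p : p \in s1 -> 0 < p.2 by move=> /s1top/top_s/s_gt0.
have sep1 : separated s1.
  split.
    by rewrite map_inj_in_uniq// => u v uc' vc guv; rewrite -(gK _ uc') guv gK.
  move=> _ _ /mapP[u uc' ->] /mapP[v vc ->] guv; rewrite !gK//.
  have uv : u != v by apply: contraNneq guv => ->.
  apply: le_lt_trans (sep _ _ uc' vc uv).
  by have := top_le _ (gtop _ uc'); have := top_le _ (gtop _ vc); lra.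
pose away p := all (fun q => p.2 + q.2 < N (p.1 - q.1)) s1.
pose rest := [seq p <- s | (j p < j p0) && away p].
have rest_s p : p \in rest -> p \in s by rewrite mem_filter => /andP[].
have [||||s2 [s2s sep2 hs2]] := IH rest.
- apply: leq_trans sn; rewrite size_filter.
  rewrite -(count_predC (fun p => (j p < j p0) && away p) s).
  rewrite -[X in (X < _)%N]addn0 ltn_add2l -has_count; apply/hasP; exists p0 => //=.
  by rewrite ltxx.
- by move=> p /rest_s/s_gt0.
- by move=> p q /rest_s ps /rest_s; exact: same.
- by move=> p q /rest_s ps /rest_s; exact: lower.
have far p q : p \in s1 -> q \in s2 -> q.2 + p.2 < N (q.1 - p.1).
  move=> p1 /s2s; rewrite mem_filter => /andP[/andP[_ /allP h] _]; exact: h.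
have s2_gt0 p : p \in s2 -> 0 < p.2 by move=> /s2s/rest_s/s_gt0.
exists (s1 ++ s2); split.
- move=> p; rewrite mem_cat => /orP[/s1top/top_s//|/s2s/rest_s//].
- split.
    rewrite cat_uniq sep1.1 sep2.1 andbT/=; apply/hasPn => q q2; apply/negP => q1.
    have := far _ _ q1 q2; rewrite subrr (body_norm0 cbK).
    by have := s1_gt0 _ q1; lra.
  move=> p q; rewrite !mem_cat => /orP[p1|p2] /orP[q1|q2] pq.
  + exact: sep1.2.
  + by rewrite (body_norm_dist cbK) addrC; exact: far.
  + exact: far.
  + exact: sep2.2.
have mdouble : measurable (\bigcup_(q in [set` s1]) ball_at q.1 (2 * q.2)).
  apply: fin_bigcup_measurable => // q /= /s1_gt0 q0.
  by apply: measurable_body_ball_at => //; exact: mulr_gt0.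
have mtop' : measurable (union_balls K (map fst top) t) by exact: measurable_union_balls.
have mrest : measurable (cover rest) by apply: measurable_cover => // p /rest_s/s_gt0.
(* A ball is in the top class, or meets a selected ball and lies in its double, or is left to the
   recursion. *)
have sub : cover s `<=` union_balls K (map fst top) t `|`
    ((\bigcup_(q in [set` s1]) ball_at q.1 (2 * q.2)) `|` cover rest).
  move=> y [p /= ps py]; have [jp|jp] := eqVneq (j p) (j p0).
    have ptop : p \in top by rewrite mem_filter jp eqxx.
    left; exists p.1; first exact: map_f.
    exact: le_trans py (top_le _ ptop).
  have {}jp : j p < j p0 by rewrite lt_neqAle jp p0max.
  right; have [pa|/allPn[q q1]] := boolP (away p).
    by right; exists p => //=; rewrite mem_filter jp pa.
  rewrite -leNgt => pq; left; exists q => //.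
  have jq : j q = j p0.
    by have := s1top _ q1; rewrite mem_filter => /andP[/eqP].
  have pq2 : 2 * p.2 <= q.2 by apply: lower => //; [exact/top_s/s1top|rewrite jq].
  rewrite /body_ball_at/= -(subrK p.1 (\row_i tnth y i)) -addrA.
  apply: (le_trans (body_norm_triangle cbK _ _)).
  by have : N (\row_i tnth y i - p.1) <= p.2 := py; lra.
have hdouble : (mu (\bigcup_(q in [set` s1]) ball_at q.1 (2 * q.2)) <=
    (2 ^+ d * (vol * mass s1))%:E)%E.
  rewrite bigcup_seq; apply: (le_trans (y := \sum_(q <- s1) (2 ^+ d * (vol * q.2 ^+ d))%:E)%E).
    rewrite big_seq [leRHS]big_seq.
    apply: (le_trans (measure_bigsetU_le _ _ _)) => [q /s1_gt0 q0|].
      by apply: measurable_body_ball_at => //; exact: mulr_gt0.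
    apply: lee_sum => q /s1_gt0 q0.
    have q20 : 0 < 2 * q.2 by exact: mulr_gt0.
    rewrite [leLHS](measure_body_ball_at cbK q.1 q20) lee_fin exprMn.
    by rewrite -mulrA (mulrC vol).
  by rewrite sumEFin /mass !mulr_sumr.
(* Returning from the common radius to the original ones costs [rho ^+ d], since every radius is at
   least [m.2]. *)
have hmass : t ^+ d * vol * (size c)%:R <= rho ^+ d * (vol * mass s1).
  rewrite exprMn -!mulrA ler_wpM2l ?exprn_ge0 ?(ltW rho0)//.
  rewrite mulrCA ler_wpM2l ?(ltW (body_volume_gt0 cbK))//.
  have -> : m.2 ^+ d * (size c)%:R = \sum_(v <- c) m.2 ^+ d.
    by rewrite big_const_seq count_predT iter_addr_0 mulr_natr.
  rewrite /mass big_map [leLHS]big_seq [leRHS]big_seq; apply: ler_sum => v /gtop vtop.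
  by rewrite lerXn2r// ?nnegrE ?(ltW m0) ?mmin// (le_trans (ltW m0))// mmin.
have const0 : 0 <= const.
  by have r1 := radius_ge1 cbK; rewrite addr_ge0// exprn_ge0//; lra.
apply: (@le_trans _ _ (mu (union_balls K (map fst top) t) +
    (mu (\bigcup_(q in [set` s1]) ball_at q.1 (2 * q.2)) + mu (cover rest)))%E).
  apply: (@le_trans _ _ (mu (union_balls K (map fst top) t `|`
    ((\bigcup_(q in [set` s1]) ball_at q.1 (2 * q.2)) `|` cover rest)))).
    apply: le_measure; rewrite ?inE//; first exact: measurable_cover.
    by do 2!apply: measurableU => //.
  apply: (le_trans (measureU2 _ _ _)) => //; first exact: measurableU.
  by apply: leeD => //; exact: measureU2.
apply: (le_trans (leeD hc (leeD hdouble hs2))).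
rewrite -!EFinD lee_fin /mass big_cat/= -/(mass s1) -/(mass s2).
have := ler_wpM2l const0 hmass; lra.
Qed.

(** Applies [scale_classes_fraction] to each residue class modulo [d.+1] of the logarithmic scale,
    then keeps the selection of largest mass. *)
Lemma homothets_fraction s : (0 < d)%N -> {in s, forall p, 0 < p.2} ->
  exists s', [/\ {subset s' <= s}, separated s' &
    (mu (cover s) <=
      (d.+1%:R * (const * expR 1 + 2 ^+ d) * (vol * mass s'))%:E)%E].
Proof.
move=> d0 s_gt0.
have dR0 : 0 < d%:R :> R by rewrite ltr0n.
pose rho : R := 1 + d%:R^-1.
have rho1 : 1 < rho by rewrite ltrDl invr_gt0.
have rho0 : 0 < rho by lra.
have rho_le : rho ^+ d <= expR 1.
  rewrite -[X in expR X](mulfV (lt0r_neq0 dR0)) expRM_natl.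
  by apply: lerXn2r; rewrite ?nnegrE ?expR_ge0 ?(ltW rho0)//; exact: expR_ge1Dx.
have rho_ge : 2 <= rho ^+ d.
  have bernoulli n : 1 + n%:R * d%:R^-1 <= rho ^+ n.
    elim: n => [|n IH]; first by rewrite mul0r addr0 expr0.
    have dV0 : 0 < d%:R^-1 :> R by rewrite invr_gt0.
    have n0 : 0 <= n%:R :> R by [].
    rewrite exprS -natr1 (le_trans _ (ler_wpM2l (ltW rho0) IH))// /rho.
    nra.
  by apply: le_trans (bernoulli d); rewrite mulfV ?gt_eqF.
have lnrho : 0 < ln rho by exact: ln_gt0.
(* Logarithm of the radius to base [rho]; its floor [j p] is the scale of the ball. *)
pose L (p : rball) : R := ln p.2 / ln rho.
pose j p := Num.floor (L p).
pose class i := [seq p <- s | (j p %% d.+1%:Z)%Z == i].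
have class_s i p : p \in class i -> p \in s by rewrite mem_filter => /andP[].
have hclass (i : 'I_d.+1) : exists s', [/\ {subset s' <= class i}, separated s' &
    (mu (cover (class i)) <= ((const * rho ^+ d + 2 ^+ d) * (vol * mass s'))%:E)%E].
  apply: (@scale_classes_fraction rho j) => //.
  - by move=> p /class_s/s_gt0.
  - move=> p q /class_s/s_gt0 p0 /class_s/s_gt0 q0 jpq.
    have : L p < L q + 1.
      apply: lt_le_trans (floorD1_gt _) _.
      by rewrite -/(j p) jpq intrD lerD2r floor_le.
    rewrite /L ltr_pdivrMr// mulrDl mul1r divfK ?gt_eqF// -lnM ?posrE//.
    by rewrite ltr_ln ?posrE ?mulr_gt0// mulrC => /ltW.
  - move=> p q pc qc jpq.
    have p0 := s_gt0 _ (class_s _ _ pc); have q0 := s_gt0 _ (class_s _ _ qc).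
    (* Distinct scales with the same residue differ by at least [d.+1]. Taking floors loses less
       than 1, so the logarithms differ by more than [d] and the radii by a factor above [rho ^+ d],
       which is at least 2. *)
    have jN : j p + d.+1%:Z <= j q.
      move: pc qc; rewrite !mem_filter => /andP[/eqP ip _] /andP[/eqP iq _].
      move: (divz_eq (j p) d.+1) (divz_eq (j q) d.+1) jpq; rewrite ip iq.
      move: (j p %/ _)%Z (j q %/ _)%Z => a b -> ->; rewrite ltrD2r ltr_pM2r// addrAC lerD2r => ab.
      by rewrite -[X in _ + X]mul1r -mulrDl ler_pM2r//; lia.
    have : L p + d%:R < L q.
      have := floorD1_gt (L p); have := floor_le (L q).
      rewrite -/(j p) -/(j q); have : (j p + d.+1%:Z)%:~R <= (j q)%:~R :> R.
        by rewrite ler_int.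
      by rewrite !intrD -addn1 PoszD intrD /=; lra.
    rewrite /L -(ltr_pM2r lnrho) mulrDl !divfK ?gt_eqF// (mulr_natl (ln rho)) -lnXn//.
    rewrite -lnM ?posrE ?exprn_gt0// ltr_ln ?posrE ?mulr_gt0 ?exprn_gt0// => h.
    apply: le_trans (ltW h); rewrite mulrC ler_pM2l//.
have [f fP] := choice hclass.
have [i0 _ imax] := @exists_argmax _ _ (fun i => mass (f i)) (enum 'I_d.+1) ltac:(by rewrite -size_eq0 size_enum_ord).
have [f_s sepf _] := fP i0.
have const0 : 0 <= const.
  by have r1 := radius_ge1 cbK; rewrite addr_ge0// exprn_ge0//; lra.
have vol0 := body_volume_gt0 cbK.
exists (f i0); split=> //; first by move=> p /f_s/class_s.
have mclass i : measurable (cover (class i)).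
  by apply: measurable_cover => // p /class_s/s_gt0.
have mass_ge0 i : 0 <= mass (f i).
  have [fi_s _ _] := fP i.
  rewrite /mass big_seq; apply: sumr_ge0 => p /fi_s/class_s/s_gt0 p0.
  by rewrite exprn_ge0// ltW.
apply: (@le_trans _ _ (mu (\big[setU/set0]_(i < d.+1) cover (class i)))).
  apply: le_measure; rewrite ?inE; first exact: measurable_cover.
    by elim/big_ind: _ => //; exact: measurableU.
  move=> t [p /= ps pt].
  have mod_ge0 := modz_ge0 (j p) (isT : d.+1%:Z != 0).
  have jlt : (`|(j p %% d.+1%:Z)%Z| < d.+1)%N.
    by have := ltz_pmod (j p) (isT : 0 < d.+1%:Z); lia.
  rewrite (bigD1 (Ordinal jlt))//=; left; exists p => //=.
  by rewrite mem_filter ps andbT gez0_abs.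
apply: (le_trans (measure_bigsetU_le mu (F := fun i : 'I_d.+1 => cover (class i))
  (index_enum _) (fun i _ => mclass i))).
have bound i : (mu (cover (class (i : 'I_d.+1))) <=
    ((const * expR 1 + 2 ^+ d) * (vol * mass (f i0)))%:E)%E.
  have [_ _ hi] := fP i; apply: le_trans hi _; rewrite lee_fin.
  have h1 : mass (f i) <= mass (f i0) by apply: imax; rewrite mem_enum.
  apply: ler_pM.
  - by rewrite addr_ge0 ?mulr_ge0 ?exprn_ge0 ?(ltW rho0).
  - by rewrite mulr_ge0// ltW.
  - by rewrite lerD2r ler_wpM2l.
  - by rewrite ler_pM2l.
apply: (le_trans (lee_sum _ (fun i _ => bound i))).
by rewrite sumEFin sumr_const card_ord lee_fin -[leLHS]mulr_natl mulrA.
Qed.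

End homothets.

Theorem corollary3p3 (R : realType) :
  (forall (d : nat) (K : set 'rV[R]_d), (0 < d)%N -> symmetric_convex_body K ->
     (2 ^+ d + (3 - 2 * modulus_of_convexity K (1 / 2)) ^+ d)^-1 <= f_const K)
  /\
  (exists eps : nat -> R,
     [/\ eps n @[n --> \oo] --> (0 : R),
         forall d : nat, (2 <= d)%N -> 0 < expR 1 + eps d &
         forall (d : nat) (K : set 'rV[R]_d), (2 <= d)%N ->
           symmetric_convex_body K ->
           (expR 1 + eps d)^-1 * (d%:R * ln d%:R)^-1
             * (2 ^+ d + (3 - 2 * modulus_of_convexity K (1 / 2)) ^+ d)^-1
           <= F_const K]).
Proof.
have const_gt0 d (K : set 'rV[R]_d) : symmetric_convex_body K ->
    0 < 2 ^+ d + (3 - 2 * modulus_of_convexity K (1 / 2)) ^+ d.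
  move=> cbK; have r1 := radius_ge1 cbK.
  by rewrite ltr_wpDr// ?exprn_gt0// exprn_ge0//; lra.
split=> [d K _ cbK|].
  have c0 := const_gt0 _ _ cbK.
  apply: (disjoint_constant_ge cbK).
  - by rewrite invr_ge0 ltW.
  - exists 0; apply/seteqP; split=> x /=; last by case=> y Ky <-; rewrite add0r.
    by move=> Kx; exists x; rewrite ?add0r.
  (* Translates are the homothets of ratio exactly 1. *)
  have -> : translates K = [set A | exists v l, l = 1 /\ A = [set v + l *: x | x in K]].
    apply/seteqP; split=> A /=.
      by case=> v ->; exists v, 1; split=> //; under [RHS]eq_imagel do rewrite scale1r.
    by case=> v [l [-> ->]]; exists v; under eq_imagel do rewrite scale1r.
  apply: (disjoint_fraction_balls cbK); rewrite ?invr_gt0//; first by move=> l ->.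
  by move=> s /(translates_fraction cbK); rewrite invrK.
exists (fun d => 2 * (expR 1 + 1) / ln d%:R); have e0 : 0 < expR 1 :> R := expR_gt0 1.
have ln_gt0' d : (2 <= d)%N -> 0 < ln d%:R :> R by move=> d2; apply: ln_gt0; rewrite ltr1n.
split.
- rewrite -[X in _ --> X](mulr0 (2 * (expR 1 + 1))); apply: cvgMl_tmp.
  apply/(@gtr0_cvgV0 _ _ \oo _ (fun n => ln n%:R)).
    by near=> n; apply: ln_gt0'; near: n; exact: nbhs_infty_ge.
  apply/cvgryPge => A; near=> n; rewrite -(expRK A).
  have An : expR A <= n%:R by near: n; exact: nbhs_infty_ger.
  by rewrite ler_ln ?posrE ?expR_gt0// (lt_le_trans (expR_gt0 A)).
- move=> d /ln_gt0' d0; rewrite addr_gt0// divr_gt0//; lra.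
move=> d K d2 cbK; have c0 := const_gt0 _ _ cbK.
set c := 2 ^+ d + _ ^+ d in c0 *.
have ld := ln_gt0' d d2; have dR : 2 <= d%:R :> R by rewrite ler_nat.
pose C := d.+1%:R * (c * expR 1 + 2 ^+ d).
have C0 : 0 < C by rewrite mulr_gt0// addr_gt0// ?mulr_gt0// exprn_gt0.
apply: (@le_trans _ _ C^-1).
  (* After expansion the logarithm cancels in the second term, leaving
     [2 * d%:R * ((expR 1 + 1) * c)]. This alone dominates [C], as [d + 1] is at most [2 * d] and
     [2 ^+ d] at most [c]. *)
  have e1 : C <= (expR 1 + 2 * (expR 1 + 1) / ln d%:R) * (d%:R * ln d%:R) * c.
    have c2 : 2 ^+ d <= c.
      by rewrite lerDl exprn_ge0//; have := radius_ge1 cbK; lra.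
    have -> : (expR 1 + 2 * (expR 1 + 1) / ln d%:R) * (d%:R * ln d%:R) * c =
        expR 1 * (d%:R * ln d%:R) * c + 2 * d%:R * ((expR 1 + 1) * c).
      by field; rewrite gt_eqF.
    rewrite /C -natr1.
    have h1 : d%:R + 1 <= 2 * d%:R :> R by lra.
    have h2 : c * expR 1 + 2 ^+ d <= (expR 1 + 1) * c by lra.
    have h3 : 0 <= c * expR 1 + 2 ^+ d by rewrite addr_ge0 ?mulr_ge0 ?exprn_ge0 ?expR_ge0 ?(ltW c0).
    have h4 : 0 <= d%:R + 1 :> R by lra.
    apply: le_trans (ler_pM h4 h3 h1 h2) _.
    by rewrite lerDr !mulr_ge0 ?expR_ge0 ?(ltW c0) ?(ltW ld).
  by rewrite -!invfM lef_pV2 ?posrE// (lt_le_trans C0).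
apply: (disjoint_constant_ge cbK); first by rewrite invr_ge0 ltW.
  exists 0, 1; split=> //; apply/seteqP; split=> x /=.
    by move=> Kx; exists x; rewrite ?add0r ?scale1r.
  by case=> y Ky <-; rewrite add0r scale1r.
apply: (disjoint_fraction_balls cbK); rewrite ?invr_gt0//.
move=> s s_gt0; have [s' [s's sep hs']] := homothets_fraction cbK (ltnW d2) s_gt0.
by exists s'; split=> //; rewrite invrK.
Unshelve. all: by end_near. Qed.
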